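(* The star-Rothberger and the strongly star-Rothberger properties are not inverse invariant under open perfect mappings: there exist spaces $X,Y$ and an open perfect mapping $f$ from $X$ onto $Y$ such that $Y$ is star-Rothberger (respectively, strongly star-Rothberger) but $X$ is not star-Rothberger (respectively, not strongly star-Rothberger). Moreover, the product of a star-Rothberger (respectively, strongly star-Rothberger) space with a compact space need not be star-Rothberger (respectively, strongly star-Rothberger): there exist a star-Rothberger (respectively, strongly star-Rothberger) space $X$ and a compact space $Y$ such that $X\times Y$ is not star-Rothberger (respectively, not strongly star-Rothberger).
   Context: For a subset $A$ of a space $X$ and a collection $\mathcal{P}$ of subsets of $X$, $St(A,\mathcal{P})=\bigcup\{B\in\mathcal{P} : A\cap B\neq\emptyset\}$, and $St(x,\mathcal{P})=St(\{x\},\mathcal{P})$. A space $X$ is star-Rothberger if for each sequence $(\mathcal{U}_n)_{n\in\mathbb{N}}$ of open covers of $X$ there exist $V_n\in\mathcal{U}_n$ ($n\in\mathbb{N}$) such that $\{St(V_n,\mathcal{U}_n) : n\in\mathbb{N}\}$ covers $X$. $X$ is strongly star-Rothberger if for each sequence $(\mathcal{U}_n)_{n\in\mathbb{N}}$ of open covers of $X$ there exist points $x_n\in X$ ($n\in\mathbb{N}$) such that $\{St(x_n,\mathcal{U}_n) : n\in\mathbb{N}\}$ covers $X$. A mapping is perfect if it is continuous, closed, and has compact fibres. *)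

(* Defs.v *)
From mathcomp Require Import all_boot all_order.
From mathcomp Require Import all_classical all_analysis.

Set Implicit Arguments.
Unset Strict Implicit.
Unset Printing Implicit Defensive.

Local Open Scope classical_set_scope.

Definition open_cover (X : topologicalType) (U : set (set X)) : Prop :=
  (forall B, U B -> open B) /\ \bigcup_(B in U) B = [set: X].

Definition St (X : Type) (A : set X) (P : set (set X)) : set X :=
  \bigcup_(B in [set B | P B /\ A `&` B !=set0]) B.

(* Read literally, the next two properties fail for the empty space: it has
   no point, and the empty family is an open cover of it with no member. *)
Definition star_Rothberger (X : topologicalType) : Prop :=
  forall U : nat -> set (set X), (forall n, open_cover (U n)) ->
  exists V : nat -> set X,
    (forall n, U n (V n)) /\ \bigcup_n St (V n) (U n) = [set: X].

Definition strongly_star_Rothberger (X : topologicalType) : Prop :=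
  forall U : nat -> set (set X), (forall n, open_cover (U n)) ->
  exists x : nat -> X, \bigcup_n St [set x n] (U n) = [set: X].

Definition open_map (X Y : topologicalType) (f : X -> Y) : Prop :=
  forall A : set X, open A -> open (f @` A).

Definition closed_map (X Y : topologicalType) (f : X -> Y) : Prop :=
  forall A : set X, closed A -> closed (f @` A).

Definition perfect_map (X Y : topologicalType) (f : X -> Y) : Prop :=
  [/\ continuous f, closed_map f & forall y, compact (f @^-1` [set y])].

(* Main.v *)
Require Import Defs.
From mathcomp Require Import all_boot all_order.
From mathcomp Require Import all_classical all_analysis.
Local Open Scope classical_set_scope.

(** A one-point space is strongly star-Rothberger and is the image of every
    nonempty compact space under an open perfect map, so it suffices to find a
    compact space that is not star-Rothberger.  In the Cantor space [2^N] let
    [U_n] be the partition according to the [n]-th coordinate.  The star of a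
    member of a partition is that member, and whichever half [V_n] of [U_n] is
    selected for each [n], the point that lies in the other half for every [n]
    is not covered. *)

(** Enlarge each [x n] to a member [V n] of [U n] containing it: every member of [U n] through [x n]
    then meets [V n]. By contraposition, one counterexample to the weaker property serves for
    both. *)
Lemma strongly_star_Rothberger_star (X : topologicalType) :
  strongly_star_Rothberger X -> star_Rothberger X.
Proof.
move=> ssX U Ucov; have [x xcov] := ssX U Ucov.
have /choice[V UV] n : exists B, U n B /\ B (x n).
  have [_ Un] := Ucov n; have : [set: X] (x n) by [].
  by rewrite -Un => -[B UB Bx]; exists B.
exists V; split=> [n|]; first by case: (UV n).
apply/seteqP; split=> // y _; have : [set: X] y by [].
rewrite -xcov => -[n _ [B [UB [_ [-> Bx]]] By]].
by exists n => //; exists B => //; split=> //; exists (x n); case: (UV n).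
Qed.

Lemma strongly_star_Rothberger_point (X : topologicalType) (x0 : X) :
  (forall x, x = x0) -> strongly_star_Rothberger X.
Proof.
move=> Xx0 U Ucov; exists (fun=> x0); apply/seteqP; split=> // x _.
have [_ U0] := Ucov 0; have : [set: X] x by [].
rewrite -U0 => -[B UB Bx]; exists 0 => //; exists B => //.
by split=> //; exists x; split=> //; exact: Xx0.
Qed.

(** The coordinates are abstract so that the argument covers both the Cantor space and its product
    with another space, where they are read off the second factor. *)
Lemma not_star_Rothberger_of_coordinates (X : topologicalType)
    (c : nat -> X -> bool) :
  (forall n, continuous (c n)) ->
  (forall b : nat -> bool, exists x, forall n, c n x = b n) ->
  ~ star_Rothberger X.
Proof.
move=> c_cont c_surj sX.
pose U n := range (fun b => c n @^-1` [set b]).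
have Ucov n : open_cover (U n).
  split=> [_ [b _ <-]|]; last first.
    apply/seteqP; split=> // x _.
    by exists (c n @^-1` [set c n x]) => //; exists (c n x).
  by apply: open_comp; [move=> x _; exact: c_cont | exact: discrete_open].
have [V [UV Vcov]] := sX U Ucov.
have /choice[b Vb] n : exists b, V n = c n @^-1` [set b].
  by case: (UV n) => b _ <-; exists b.
have [x xb] := c_surj (fun n => ~~ b n).
have : [set: X] x by [].
(* A half [d] that meets [V n] at [y] satisfies [d = b n], whereas [x] in that half gives
   [d = ~~ b n]. *)
rewrite -Vcov => -[n _ [_ [[d _ <-] [y []]]]].
rewrite Vb /= => -> <-; rewrite xb.
by case: (b n).
Qed.

Lemma continuous_coordinate (n : nat) :
  continuous (fun x : cantor_space => x n).
Proof. exact: (@proj_continuous nat (fun=> bool)). Qed.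

Lemma cantor_space_not_star_Rothberger : ~ star_Rothberger cantor_space.
Proof.
apply: (@not_star_Rothberger_of_coordinates cantor_space (fun n x => x n)).
  exact: continuous_coordinate.
by move=> b; exists b.
Qed.

Lemma prod_cantor_space_not_star_Rothberger (X : topologicalType) (x0 : X) :
  ~ star_Rothberger (X * cantor_space)%type.
Proof.
apply: (@not_star_Rothberger_of_coordinates (X * cantor_space)%type
          (fun n p => p.2 n)).
  move=> n p; apply: (@continuous_comp _ _ _ snd (fun x : cantor_space => x n)).
    exact: cvg_snd.
  exact: continuous_coordinate.
by move=> b; exists (x0, b).
Qed.

(** With the discrete topology all images are open and closed at once. *)
Definition one_point : topologicalType := discrete_topology unit.

Lemma strongly_star_Rothberger_one_point : strongly_star_Rothberger one_point.
Proof. by apply: (@strongly_star_Rothberger_point one_point tt) => -[]. Qed.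

Lemma perfect_map_one_point (X : topologicalType) (x0 : X) :
  compact [set: X] ->
  let f : X -> one_point := fun=> tt in
  [/\ open_map f, perfect_map f & range f = [set: one_point]].
Proof.
move=> Xcpt f; split.
- by move=> A _; exact: discrete_open.
- split=> [x|A _|[]]; [exact: cst_continuous | exact: discrete_closed |].
  (* The only fibre is the whole space. *)
  by rewrite (_ : _ @^-1` _ = setT) //; apply/seteqP.
- by apply/seteqP; split=> // -[] _; exists x0.
Qed.

Theorem mainTheorem2 :
  [/\ exists (X Y : topologicalType) (f : X -> Y),
        [/\ open_map f, perfect_map f & range f = [set: Y]] /\
        star_Rothberger Y /\ ~ star_Rothberger X,
      exists (X Y : topologicalType) (f : X -> Y),
        [/\ open_map f, perfect_map f & range f = [set: Y]] /\
        strongly_star_Rothberger Y /\ ~ strongly_star_Rothberger X,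
      exists X Y : topologicalType,
        [/\ star_Rothberger X, [set: Y] !=set0, compact [set: Y] &
            ~ star_Rothberger (X * Y)%type] &
      exists X Y : topologicalType,
        [/\ strongly_star_Rothberger X, [set: Y] !=set0, compact [set: Y] &
            ~ strongly_star_Rothberger (X * Y)%type]].
Proof.
have ssY := strongly_star_Rothberger_one_point.
have sY := strongly_star_Rothberger_star _ ssY.
have ncantor := cantor_space_not_star_Rothberger.
have nprod := @prod_cantor_space_not_star_Rothberger one_point tt.
pose x0 : cantor_space := fun=> false.
have fP := perfect_map_one_point cantor_space x0 cantor_space_compact.
split.
- by exists cantor_space, one_point, (fun=> tt).
- exists cantor_space, one_point, (fun=> tt); do 2!split=> //.
  by move=> /strongly_star_Rothberger_star.
- exists one_point, cantor_space; split=> //; last exact: cantor_space_compact.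
  by exists x0.
- exists one_point, cantor_space; split=> //.
  + by exists x0.
  + exact: cantor_space_compact.
  (* The implication reduces this to [nprod]. *)
  + by move=> /strongly_star_Rothberger_star.
Qed.
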